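(* Let $(X,d)$ be a compact metric space, let $f_1,f_2:X\to X$ be continuous maps, and let $F=\{f_1,f_2\}$ be the associated multiple mappings. If $F$ is transitive and the set $P(F)$ of periodic points of $F$ satisfies $\overline{P(F)}=X$, then $F$ is sensitive.
   Context: For $F=\{f_1,f_2\}$, an integer $n>0$ and $x\in X$, put $$F^n(x)=\{f_{i_1}f_{i_2}\cdots f_{i_n}(x)\mid i_1,\dots,i_n\in\{1,2\}\}\subset X,$$ where juxtaposition denotes composition; in particular $F(x)=F^1(x)=\{f_1(x),f_2(x)\}$. The deleted orbit of $x$ under $F$ is the set of subsets $\mathring{orb}(x,F)=\{F(x),F^2(x),F^3(x),\dots\}$. A point $x\in X$ is a periodic point of $F$ if $\mathring{orb}(x,F)$ is finite (as a set of subsets of $X$) and there exists an integer $m>0$ such that $x\in F^m(x)$. $P(F)$ denotes the set of all periodic points of $F$. Let $\mathbb{K}(X)$ be the set of nonempty compact subsets of $X$, with the Hausdorff metric $$d_H(A,B)=\max\Big\{\sup_{a\in A}\inf_{b\in B}d(a,b),\ \sup_{b\in B}\inf_{a\in A}d(a,b)\Big\},$$ and let $Ran(F)=\{F^n(x)\mid n\ge 1,\ x\in X\}\subset\mathbb{K}(X)$, with the subspace topology induced by $d_H$. $F$ is (topologically) transitive if for any nonempty open set $U\subset X$ and any nonempty open set $\mathcal{U}\subset Ran(F)$ (open in $Ran(F)$), there exists an integer $n\ge 1$ such that $\{F^n(u)\mid u\in U\}\cap\mathcal{U}\neq\emptyset$. $F$ is (Hausdorff metric) sensitive if there exists $\delta>0$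 such that for any nonempty open set $U\subset X$ there exist $x,y\in U$ and an integer $n\ge 1$ such that $d_H(F^n(x),F^n(y))>\delta$.
   Formalization: The formal theorem additionally assumes that X is infinite; without this the claim fails, e.g. for X a single point with f1 = f2 = id, and no nonempty finite X is ever sensitive. *)

(* Defs.v *)
From HB Require Import structures.
From mathcomp Require Import all_boot all_order all_algebra.
From mathcomp Require Import all_classical all_reals all_analysis.

Set Implicit Arguments.
Unset Strict Implicit.
Unset Printing Implicit Defensive.

Import Order.TTheory GRing.Theory Num.Theory.
Local Open Scope classical_set_scope.
Local Open Scope ring_scope.

Section MultipleMappings.
Context {X : Type} (f1 f2 : X -> X).

(* The letter [true] stands for f1 and [false] for f2; the word
   [:: i1; ...; in] acts as x |-> f_i1 (f_i2 (... (f_in x))). *)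
Definition word_act (w : seq bool) (x : X) : X :=
  foldr (fun i : bool => if i then f1 else f2) x w.

Definition Fiter (n : nat) (x : X) : set X :=
  [set word_act w x | w in [set: n.-tuple bool]].

Definition deleted_orbit (x : X) : set (set X) :=
  [set Fiter n x | n in [set n : nat | (0 < n)%N]].

Definition periodic_point (x : X) : Prop :=
  finite_set (deleted_orbit x) /\ exists2 m : nat, (0 < m)%N & Fiter m x x.

Definition periodic_points : set X := [set x | periodic_point x].

Definition Ran : set (set X) :=
  [set A | exists n x, (0 < n)%N /\ A = Fiter n x].

End MultipleMappings.

Section Hausdorff.
Context {R : realType} {X : metricType R}.

(* The real-valued [sup] and [inf] are the intended ones when A and B are
   nonempty and bounded, in particular on [hyperspace]. *)
Definition hausdorff_dist (A B : set X) : R :=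
  Num.max (sup [set inf [set mdist a b | b in B] | a in A])
          (sup [set inf [set mdist a b | a in A] | b in B]).

Definition hyperspace : set (set X) := [set A | A !=set0 /\ compact A].

Definition hyperspace_open (W : set (set X)) : Prop :=
  W `<=` hyperspace /\
  forall A, W A -> exists2 e : R, 0 < e &
    forall B, hyperspace B -> hausdorff_dist A B < e -> W B.

Variables f1 f2 : X -> X.

(* Subspace topology; [Ran_sub_hyperspace] below gives Ran(F) `<=` K(X). *)
Definition Ran_open (V : set (set X)) : Prop :=
  exists2 W, hyperspace_open W & V = W `&` Ran f1 f2.

Definition mm_transitive : Prop :=
  forall (U : set X) (V : set (set X)),
    open U -> U !=set0 -> Ran_open V -> V !=set0 ->
    exists2 n : nat, (0 < n)%N & [set Fiter f1 f2 n u | u in U] `&` V !=set0.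

Definition mm_sensitive : Prop :=
  exists2 delta : R, 0 < delta &
    forall U : set X, open U -> U !=set0 ->
      exists x y (n : nat), [/\ U x, U y, (0 < n)%N &
        delta < hausdorff_dist (Fiter f1 f2 n x) (Fiter f1 f2 n y)].

Lemma Ran_sub_hyperspace : Ran f1 f2 `<=` hyperspace.
Proof.
move=> A [n [x [_ ->]]]; split.
  by exists (word_act f1 f2 (nseq_tuple n true) x), (nseq_tuple n true).
by apply: finite_compact; apply: finite_image; exact: finite_finset.
Qed.

End Hausdorff.

(* Main.v *)
Require Import Defs.
From HB Require Import structures.
From mathcomp Require Import all_boot all_order all_algebra.
From mathcomp Require Import all_classical all_reals all_analysis.
From mathcomp Require Import lra.

(** Let [e] be a periodic point, let [E] be the union of its deleted orbit, a
finite set, and let [w] be a periodic point outside [E]; the sensitivity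
constant is a fraction of the distance from [w] to [E]. Given a nonempty open
[U], pick a periodic [p] in [U] with [p] in [F^m p], so that [F^n p] is
contained in [F^(n+m) p] for all [n]. By transitivity some [u1] in [U] has an
iterate [F^n1 u1] meeting a small ball around [w], and some [u2] in [U] has
iterates that stay close to [E] during a block of more than [n1 + m]
consecutive times. If the orbits of [u1], [p] and [u2] were uniformly close,
[F^n1 p], hence every [F^(n1 + i m) p], would meet a neighbourhood of [w]; one
of the times [n1 + i m] lies in the block where [F^n u2] is close to [E], a
contradiction. *)

Set Implicit Arguments.
Unset Strict Implicit.
Unset Printing Implicit Defensive.

Import Order.TTheory GRing.Theory Num.Theory.
Local Open Scope classical_set_scope.
Local Open Scope ring_scope.

Section Words.
Context {X : Type} (f1 f2 : X -> X).

Lemma word_act_cat v w x :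
  word_act f1 f2 (v ++ w) x = word_act f1 f2 v (word_act f1 f2 w x).
Proof. exact: foldr_cat. Qed.

Lemma FiterP n x y :
  Fiter f1 f2 n x y <-> exists2 w, size w = n & word_act f1 f2 w x = y.
Proof.
split=> [[w _ <-]|[w wn <-]]; first by exists w => //; exact: size_tuple.
by move/eqP in wn; exists (Tuple wn).
Qed.

Lemma FiterD n m x y z :
  Fiter f1 f2 n x y -> Fiter f1 f2 m y z -> Fiter f1 f2 (n + m) x z.
Proof.
move=> /FiterP[v vn <-] /FiterP[w wm <-]; apply/FiterP.
by exists (w ++ v); rewrite ?word_act_cat// size_cat vn wm addnC.
Qed.

(** The rightmost letters of a word act first, so the first [n] steps are [drop m w] and the
    remaining [m] steps are [take m w]. *)
Lemma FiterD_ex n m x z :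
  Fiter f1 f2 (n + m) x z ->
  exists2 y, Fiter f1 f2 n x y & Fiter f1 f2 m y z.
Proof.
move=> /FiterP[w wnm <-]; exists (word_act f1 f2 (drop m w) x).
  by apply/FiterP; exists (drop m w); rewrite // size_drop wnm addnK.
apply/FiterP; exists (take m w); first by rewrite size_takel// wnm leq_addl.
by rewrite -word_act_cat cat_take_drop.
Qed.

Lemma Fiter_periodic m x i : Fiter f1 f2 m x x -> Fiter f1 f2 (m * i) x x.
Proof.
move=> mx; elim: i => [|i ih]; first by rewrite muln0; apply/FiterP; exists [::].
by rewrite mulnS; exact: FiterD ih.
Qed.

Lemma finite_Fiter n x : finite_set (Fiter f1 f2 n x).
Proof. by apply: finite_image; exact: finite_finset. Qed.

Lemma finite_bigcup_orbit x : finite_set (deleted_orbit f1 f2 x) ->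
  finite_set (\bigcup_(A in deleted_orbit f1 f2 x) A).
Proof.
by move=> fx; apply: bigcup_finite => // A [n _ <-]; exact: finite_Fiter.
Qed.

End Words.

(** Staying in [O] for a bounded time is thus an open condition. A nonempty word is split at its
    last letter, the one applied first, which reduces [M.+1] to preimages of the set for [M]. *)
Lemma open_word_act_preimage (T : topologicalType) (f1 f2 : T -> T) (O : set T) M :
  continuous f1 -> continuous f2 -> open O ->
  open [set x | forall w, (size w <= M)%N -> O (word_act f1 f2 w x)].
Proof.
move=> cf1 cf2 oO; elim: M => [|M ih].
  rewrite (_ : mkset _ = O)//; apply/seteqP; split=> [x /(_ [::])|x Ox w].
    exact.
  by rewrite leqn0 => /nilP ->.
set B := [set x | _] in ih.
rewrite (_ : mkset _ = O `&` (f1 @^-1` B `&` f2 @^-1` B)); last first.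
  apply/seteqP; split=> [x Bx|x [Ox [B1 B2]]].
    split; first exact: (Bx [::]).
    split=> w wM.
      by have := Bx (rcons w true); rewrite size_rcons /word_act foldr_rcons; exact.
    by have := Bx (rcons w false); rewrite size_rcons /word_act foldr_rcons; exact.
  elim/last_ind => // w [] _; rewrite size_rcons /word_act foldr_rcons => wM.
    exact: B1.
  exact: B2.
by apply: openI => //; apply: openI; apply: open_comp.
Qed.

Section HausdorffDistance.
Context {R : realType} {X : metricType R}.
Implicit Types A B : set X.

(** Supplies the upper bound without which the real-valued [sup] in [hausdorff_dist] is a default
    value. *)
Lemma compact_mdist_bounded A (b : X) : compact A ->
  exists M, forall a, A a -> mdist b a <= M.
Proof.
move=> /compact_near_coveringP cA.
have : \forall M \near +oo, A `<=` (fun a => mdist b a <= M).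
  apply: cA => x Ax.
  exists (ball x 1, [set M | mdist b x + 1 < M]) => /=.
    by split; [exact: nbhsx_ballx|apply: nbhs_pinfty_gt; exact: num_real].
  move=> [y M]/= [xy bM]; rewrite ballEmdist /= in xy.
  rewrite (le_trans (metric_triangle _ x _))// (le_trans _ (ltW bM))//.
  by rewrite lerD2l ltW.
by move=> /filter_ex[M AM]; exists M.
Qed.

Lemma hausdorff_distC A B : hausdorff_dist A B = hausdorff_dist B A.
Proof.
rewrite /hausdorff_dist maxC; congr (Num.max (sup _) (sup _));
  apply: eq_imagel => x _; congr inf; apply: eq_imagel => y _; exact: metric_sym.
Qed.

(** The distance from [a] to [B] is an infimum bounded by a supremum below [d]; strictness yields an
    actual point [b]. *)
Lemma hausdorff_dist_lt A B (d : R) (a : X) :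
  hyperspace A -> hyperspace B -> hausdorff_dist A B < d -> A a ->
  exists2 b, B b & mdist a b < d.
Proof.
move=> [_ cA] [[b0 Bb0] _]; rewrite /hausdorff_dist gt_max => /andP[ABd _] Aa.
have lbB x : has_lbound [set mdist x b | b in B].
  by exists 0 => _ [b _ <-]; exact: mdist_ge0.
have infd : inf [set mdist a b | b in B] < d.
  apply: le_lt_trans ABd; apply: ub_le_sup; last by exists a.
  have [M AM] := compact_mdist_bounded b0 cA.
  exists M => _ [x Ax <-]; apply: le_trans (AM x Ax).
  by rewrite metric_sym; apply: ge_inf => //; exists b0.
by case: (inf_lt _ infd) => [|_ [b Bb <-] abd]; [exists (mdist a b0), b0|exists b].
Qed.

Lemma hyperspace_open_meet_ball (w : X) (r : R) :
  hyperspace_open [set A | hyperspace A /\ exists2 a, A a & mdist w a < r].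
Proof.
split=> [A []//|A [hA [a Aa war]]]; exists (r - mdist w a).
  by rewrite subr_gt0.
move=> B hB AB; split=> //.
have [b Bb ab] := hausdorff_dist_lt hA hB AB Aa.
by exists b => //; rewrite (le_lt_trans (metric_triangle _ a _))// -ltrBrDl.
Qed.

(** Compactness of [A] gives one radius [e] such that the whole [e]-neighbourhood of [A] lies in
    [O]. *)
Lemma hyperspace_open_sub (O : set X) : open O ->
  hyperspace_open [set A | hyperspace A /\ A `<=` O].
Proof.
move=> oO; split=> [A []//|A [hA AO]].
have /compact_near_coveringP cA := hA.2.
have : \forall e \near (0:R)^'+, A `<=` (fun a => forall b, mdist a b < e -> O b).
  apply: cA => x Ax.
  have : nbhs x O by apply: open_nbhs_nbhs; split=> //; exact: AO.
  move=> /nbhs_ballP[e /= e0 xO].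
  exists (ball x (e / 2), [set d | d < e / 2]) => /=.
    split; first by apply: nbhsx_ballx; exact: divr_gt0.
    by apply: nbhs_right_lt; exact: divr_gt0.
  move=> [y d]/= [xy de] b yb; apply: xO.
  rewrite ballEmdist /= in xy; rewrite ballEmdist /=.
  by rewrite (le_lt_trans (metric_triangle _ y _))// [e]splitr ltrD// (lt_trans yb).
move=> /(filterI (nbhs_right_gt 0))/filter_ex[e [e0 AeO]]; exists e => //.
move=> B hB AB; split=> // b Bb; rewrite hausdorff_distC in AB.
have [a Aa ba] := hausdorff_dist_lt hB hA AB Bb.
by apply: (AeO a) => //; rewrite metric_sym.
Qed.

End HausdorffDistance.

(** The iterate of [x] witnesses that [W] meets [Ran f1 f2], as transitivity demands a nonempty open
    set there. *)
Lemma mm_transitive_ex (R : realType) (X : metricType R) (f1 f2 : X -> X)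
    (U : set X) (W : set (set X)) n x :
  mm_transitive f1 f2 -> open U -> U !=set0 -> hyperspace_open W ->
  (0 < n)%N -> W (Fiter f1 f2 n x) ->
  exists k u, [/\ (0 < k)%N, U u & W (Fiter f1 f2 k u)].
Proof.
move=> tF oU U0 oW n0 Wx.
have [||k k0 [_ [[u Uu <-] [Wu _]]]] := tF U (W `&` Ran f1 f2) oU U0.
- by exists W.
- by exists (Fiter f1 f2 n x); split=> //; exists n, x.
by exists k, u.
Qed.

Lemma dense_meets_open (T : topologicalType) (P O : set T) :
  closure P = [set: T] -> open O -> O !=set0 -> exists2 x, P x & O x.
Proof.
move=> dP oO [x Ox]; have : closure P x by rewrite dP.
by move=> /(_ O (open_nbhs_nbhs (conj oO Ox)))[y [Py Oy]]; exists y.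
Qed.

Theorem theorem4p1 (R : realType) (X : metricType R) (f1 f2 : X -> X)
    (compactX : compact [set: X]) (infiniteX : infinite_set [set: X])
    (continuous_f1 : continuous f1) (continuous_f2 : continuous f2)
    (transitiveF : mm_transitive f1 f2)
    (denseP : closure (periodic_points f1 f2) = [set: X]) :
  mm_sensitive f1 f2.
Proof.
have [x0 _] := infinite_setN0 infiniteX.
have [||e [finE _] _] := dense_meets_open denseP (O := setT).
- exact: openT.
- by exists x0.
set E := \bigcup_(A in deleted_orbit f1 f2 e) A.
have finEs : finite_set E by exact: finite_bigcup_orbit.
have oE : open (~` E).
  apply: closed_openC.
  apply: (iffLR accessible_finite_set_closed) finEs.
  exact/hausdorff_accessible/metric_hausdorff.
have [|w [_ [c c0 wc]] Ew] := dense_meets_open denseP oE.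
  apply: infinite_setN0 => finCE; apply: infiniteX.
  by rewrite -(setvU E) finite_setU.
have /nbhs_ballP[r /= r0 wE] : nbhs w (~` E) by exact: open_nbhs_nbhs.
(* Half of [r], that is [4s], keeps a neighbourhood of [E] off the ball around [w]; the final chain
   [w], [a], [b], [z] costs less than [3s]. *)
have [s s0 s8] : exists2 s : R, 0 < s & r = s *+ 8.
  by exists (r / 8); [exact: divr_gt0|rewrite -[RHS]mulr_natr divfK].
set G := (~` ball w (s *+ 4))°.
have EG : E `<=` G.
  move=> y Ey; apply/nbhs_ballP; exists (s *+ 4) => /=; first by rewrite mulrn_wgt0.
  move=> z yz wz; apply: (wE y) => //.
  rewrite ballEmdist /= in yz; rewrite ballEmdist /= in wz.
  rewrite ballEmdist /= s8 (mulrnDr s 4 4).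
  by rewrite (le_lt_trans (metric_triangle _ z _))// ltrD// metric_sym.
(* Failure of sensitivity only gives distances at most [s / 2]; the halving makes them strictly less
   than [s], as [hausdorff_dist_lt] needs. *)
exists (s / 2) => [|U oU U0]; first exact: divr_gt0.
apply: contrapT => insensitive.
have hyp n x : (0 < n)%N -> hyperspace (Fiter f1 f2 n x).
  by move=> n0; apply: (@Ran_sub_hyperspace _ _ f1 f2); exists n, x.
have close x y n z : U x -> U y -> (0 < n)%N -> Fiter f1 f2 n x z ->
    exists2 t, Fiter f1 f2 n y t & mdist z t < s.
  move=> Ux Uy n0 xz.
  apply: (hausdorff_dist_lt (hyp _ _ n0) (hyp _ _ n0) _ xz).
  rewrite ltNge; apply/negP => xy; apply: insensitive.
  exists x, y, n; split=> //; apply: lt_le_trans xy.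
  by rewrite ltr_pdivrMr// ltr_pMr// ltr1n.
have [p [_ [m m0 pm]] Up] := dense_meets_open denseP oU U0.
have cw : exists2 a, Fiter f1 f2 c w a & mdist w a < s.
  by exists w; rewrite ?mdistxx.
have [n1 [u1 [n10 Uu1 [_ [a u1a wa]]]]] := mm_transitive_ex transitiveF oU U0
  (hyperspace_open_meet_ball w s) c0 (conj (hyp c w c0) cw).
have [b pb ab] := close _ _ _ _ Uu1 Up n10 u1a.
have oO := open_word_act_preimage (n1 + m)
  continuous_f1 continuous_f2 (open_interior (~` ball w (s *+ 4))).
(* A word [v] applied to a point of [F^1 e] lands in [F^(1 + size v) e], a member of the deleted
   orbit, hence in [E]. *)
have eO : Fiter f1 f2 1 e `<=` [set x | forall v, (size v <= n1 + m)%N ->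
    G (word_act f1 f2 v x)].
  move=> x ex v _; apply: EG; exists (Fiter f1 f2 (1 + size v) e).
    by exists (1 + size v)%N.
  by apply: FiterD ex _; apply/FiterP; exists v.
have [n2 [u2 [n20 Uu2 [_ u2O]]]] := mm_transitive_ex transitiveF oU U0
  (hyperspace_open_sub oO) (ltn0Sn 0) (conj (hyp 1%N e (ltn0Sn 0)) eO).
(* The multiple of [m] lies in [(n2, n2 + m]], so [k] falls in the block from [n2] to [n2 + n1 + m],
   and going around the cycle of [p] first gives [b] in [F^k p]. *)
pose k := (m * (n2 %/ m).+1 + n1)%N.
have kb : Fiter f1 f2 k p b by apply: FiterD pb; exact: Fiter_periodic.
have k0 : (0 < k)%N by rewrite addn_gt0 n10 orbT.
have [z u2z bz] := close _ _ _ _ Up Uu2 k0 kb.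
have n2k : (n2 <= k)%N.
  by rewrite (leq_trans (ltnW (ltn_ceil n2 m0)))// mulnC leq_addr.
have kn2 : (k - n2 <= n1 + m)%N.
  by rewrite leq_subLR /k mulnS addnAC (addnC m) addnC leq_add2r mulnC
    leq_divM.
have Gz : G z.
  rewrite -(subnKC n2k) in u2z; have [y u2y yz] := FiterD_ex u2z.
  have [v vk <-] := (FiterP _ _ _ _ _).1 yz.
  by apply: (u2O y) => //; rewrite vk.
(* Membership in [G] puts [z] outside the ball of radius [4s], against the three steps shorter than
   [s] from [w] to [z]. *)
have := interior_subset Gz; apply; rewrite ballEmdist /=.
have := metric_triangle w a b; have := metric_triangle w b z.
rewrite -[s *+ 4]mulr_natr; lra.
Qed.
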